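(* Let $n,d\ge 1$ be integers, let $f_1,\dots,f_n:\mathbb{R}^d\to\mathbb{R}$ be differentiable functions, and let $f(x)=\frac1n\sum_{i=1}^n f_i(x)$. Let $x^\star\in\mathbb{R}^d$, $\alpha>0$, $\rho\in(0,1)$ and $\sigma\in(0,1)$ be such that the following two assumptions hold. (1) (Objective functions) The point $x^\star$ is a minimizer of $f$ over $\mathbb{R}^d$, and $$\bigl\|x-x^\star-\alpha\,(\nabla f_i(x)-\nabla f_i(x^\star))\bigr\|\le\rho\,\|x-x^\star\|\qquad\text{for all }x\in\mathbb{R}^d\text{ and all }i\in\{1,\dots,n\}.$$ (2) (Communication network) With $$m=\left\lceil \log_\sigma\!\left(\frac{\sqrt{1+\rho}-\sqrt{1-\rho}}{2}\right)\right\rceil ,$$ for every iteration $k\ge 0$ and every communication round $\ell\in\{1,\dots,m\}$, the gossip matrix $W^{k\ell}=\{w_{ij}^{k\ell}\}\in\mathbb{R}^{n\times n}$ used in that round is doubly stochastic and has spectral gap at most $\sigma$. Let the sequences $\{x_i^k\}_{k\ge0}$, $i\in\{1,\dots,n\}$, be generated by the algorithm described in the context, with parameters $\alpha,\rho,\sigma$, this value of $m$, the gossip matrices $W^{k\ell}$, and any initial points $x_i^0,y_i^0\in\mathbb{R}^d$ satisfying $\sum_{i=1}^n y_i^0=0$. Then the iterate sequence $\{x_i^k\}_{k\ge 0}$ of each agent converges to $x^\star$ linearly with rate $\rho$, that is, $$\|x_i^k-x^\star\|=\mathcal{O}(\rho^k)\quad\text{as }k\to\infty,\qquad\text{for all }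 i\in\{1,\dots,n\}.$$
   Context: Notation: $\mathbf{1}\in\mathbb{R}^n$ is the all-ones vector, and $\|\cdot\|$ denotes the Euclidean norm of a vector and the induced 2-norm of a matrix. Gossip matrix: for a set of $n$ agents communicating over a (possibly directed, possibly time-varying) network, a matrix $W=\{w_{ij}\}\in\mathbb{R}^{n\times n}$ is a gossip matrix if $w_{ij}=0$ whenever agent $i$ does not receive information from agent $j$. Its spectral gap is defined as $\|W-\frac1n\mathbf{1}\mathbf{1}^{\mathsf T}\|$. It is called doubly stochastic if $W\mathbf{1}=\mathbf{1}$ and $\mathbf{1}^{\mathsf T}W=\mathbf{1}^{\mathsf T}$. The network may change between rounds, so the matrices $W^{k\ell}$ may differ. Algorithm: each agent $i\in\{1,\dots,n\}$ chooses $x_i^0,y_i^0\in\mathbb{R}^d$ such that $\sum_{i=1}^n y_i^0=0$. For each iteration $k=0,1,2,\dots$, every agent $i\in\{1,\dots,n\}$ sets $v_{i,0}^k=x_i^k$, performs $m$ rounds of communication $$v_{i,\ell}^k=\sum_{j=1}^n w_{ij}^{k\ell}\,v_{j,\ell-1}^k,\qquad \ell=1,\dots,m,$$ and then updates $$u_i^k=v_{i,m}^k-\alpha\,\nabla f_i(v_{i,m}^k),\qquad y_i^{k+1}=y_i^k+x_i^k-v_{i,m}^k,\qquad x_i^{k+1}=u_i^k-\sqrt{1-\rho^2}\;y_i^{k+1}.$$ *)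

(* Defs.v *)
From mathcomp Require Import all_boot all_order all_algebra.
From mathcomp Require Import all_classical all_reals all_analysis.

Set Implicit Arguments.
Unset Strict Implicit.
Unset Printing Implicit Defensive.

Import Order.TTheory GRing.Theory Num.Theory.
Import numFieldNormedType.Exports.

Local Open Scope classical_set_scope.
Local Open Scope ring_scope.

Section Definitions.
Context {R : realType}.

(* The norm `|_| that the library puts on 'cV[R]_d is the max norm, hence this
   separate definition. Differentiability is nevertheless taken with respect to
   `|_|: the two norms are equivalent in finite dimension. *)
Definition enorm d (v : 'cV[R]_d) : R := Num.sqrt (\sum_i v i 0 ^+ 2).

(* The set below contains 0 and is bounded, so sup is a genuine supremum. *)
Definition opnorm m n (A : 'M[R]_(m, n)) : R :=
  sup [set enorm (A *m v) | v in [set v : 'cV[R]_n | enorm v <= 1]].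

Definition grad d (f : 'cV[R]_d -> R) (x : 'cV[R]_d) : 'cV[R]_d :=
  \col_(j < d) 'D_(delta_mx j 0) f x.

Definition minimizer d (f : 'cV[R]_d -> R) (xs : 'cV[R]_d) : Prop :=
  forall x, f xs <= f x.

Definition ones n : 'cV[R]_n := const_mx 1.

(* [net i j] means that agent [i] receives information from agent [j]. *)
Definition gossip_matrix n (net : rel 'I_n) (W : 'M[R]_n) : Prop :=
  forall i j, ~~ net i j -> W i j = 0.

(* Entries are not required to be nonnegative. *)
Definition doubly_stochastic n (W : 'M[R]_n) : Prop :=
  W *m ones n = ones n /\ (ones n)^T *m W = (ones n)^T.

Definition spectral_gap n (W : 'M[R]_n) : R :=
  opnorm (W - n%:R^-1 *: (ones n *m (ones n)^T)).

Definition log_base (b a : R) : R := ln a / ln b.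

(* Superscripts (the iteration k, then the round l for v and W) come first and
   the agent index last. *)
Record algorithm n d (f : 'I_n -> 'cV[R]_d -> R) (alpha rho : R) (m : nat)
    (W : nat -> nat -> 'M[R]_n)
    (x y u : nat -> 'I_n -> 'cV[R]_d)
    (v : nat -> nat -> 'I_n -> 'cV[R]_d) : Prop := Algorithm {
  algo_y_init : \sum_(i < n) y 0%N i = 0;
  algo_v_init : forall k i, v k 0%N i = x k i;
  algo_v_comm : forall k l i, (1 <= l <= m)%N ->
    v k l i = \sum_(j < n) W k l i j *: v k l.-1 j;
  algo_u : forall k i, u k i = v k m i - alpha *: grad (f i) (v k m i);
  algo_y : forall k i, y k.+1 i = y k i + x k i - v k m i;
  algo_x : forall k i,
    x k.+1 i = u k i - Num.sqrt (1 - rho ^+ 2) *: y k.+1 i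
}.

End Definitions.

(* Main.v *)
(** With s = sqrt (1 - rho^2), the algorithm has the fixed point x_i = v_i = xs,
    y_i = - (alpha / s) grad f_i (xs), whose y-components sum to zero by
    optimality. In error coordinates the gradient step gives |u| <= rho |v|, the
    communication rounds shrink the disagreement by at most
    tau = (sqrt (1 + rho) - sqrt (1 - rho)) / 2, where tau^2 = (1 - s) / 2, and
      V(x, y) = |x|^2 + 2 s <x, y> + s |y|^2 = |x + s y|^2 + s (1 - s) |y|^2
    decreases by a factor rho^2 per iteration: since x' + s y' = u and
    y' = y + x - v,
      V(x', y') - rho^2 V(x, y) <= rho^2 |v|^2 + s (1 - s) |y + x - v|^2
                                   - rho^2 V(x, y),
    which on the disagreement space equals
      - (1 - s) |s (x + y) + v|^2 + 2 rho^2 (|v|^2 - tau^2 |x|^2)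
    and is at most 0. On the consensus space y = 0 and v = x, and the right-hand
    side vanishes. *)

Require Import Defs.
From mathcomp Require Import all_boot all_order all_algebra.
From mathcomp Require Import all_classical all_reals all_analysis.
From mathcomp Require Import ring lra.

Import Order.TTheory GRing.Theory Num.Theory.
Import numFieldNormedType.Exports.

Local Open Scope classical_set_scope.
Local Open Scope ring_scope.

(** * Euclidean norm and induced operator norm *)

Section EuclideanNorm.
Context {R : realType}.

Lemma enorm_ge0 d (v : 'cV[R]_d) : 0 <= enorm v.
Proof. exact: sqrtr_ge0. Qed.

Lemma sqr_enorm d (v : 'cV[R]_d) : enorm v ^+ 2 = \sum_i v i 0 ^+ 2.
Proof. by rewrite sqr_sqrtr // sumr_ge0 // => i _; exact: sqr_ge0. Qed.

Lemma enormZ d (a : R) (v : 'cV[R]_d) : enorm (a *: v) = `|a| * enorm v.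
Proof.
rewrite /enorm; under eq_bigr => i _ do rewrite mxE exprMn.
by rewrite -mulr_sumr sqrtrM ?sqr_ge0 // sqrtr_sqr.
Qed.

Lemma enorm_eq0 d (v : 'cV[R]_d) : enorm v = 0 -> v = 0.
Proof.
move=> v0; apply/matrixP => i j; rewrite ord1 mxE.
have /eqP := sqr_enorm _ v; rewrite v0 expr0n eq_sym psumr_eq0 => [|k _].
  by move=> /allP /(_ i (mem_index_enum _)); rewrite sqrf_eq0 => /eqP.
exact: sqr_ge0.
Qed.

Lemma ler_coord_enorm d (v : 'cV[R]_d) i : `|v i 0| <= enorm v.
Proof.
rewrite -sqrtr_sqr ler_sqrt; last by rewrite sumr_ge0 // => j _; exact: sqr_ge0.
by rewrite (bigD1 i) //= lerDl sumr_ge0 // => j _; exact: sqr_ge0.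
Qed.

(** On the unit ball every coordinate of [v] is at most 1 in absolute value, so each entry of
    [A *m v] is bounded by the absolute row sum. *)
Lemma has_sup_opnorm m n (A : 'M[R]_(m, n)) :
  has_sup [set enorm (A *m v) | v in [set v : 'cV[R]_n | enorm v <= 1]].
Proof.
split.
  exists (enorm (A *m 0)), 0 => //=.
  by rewrite -(scale0r (0 : 'cV_n)) enormZ normr0 mul0r.
exists (Num.sqrt (\sum_i (\sum_j `|A i j|) ^+ 2)) => _ [v /= v1 <-].
apply: ler_wsqrtr; apply: ler_sum => i _.
rewrite mxE -real_normK ?num_real // lerXn2r ?nnegrE ?normr_ge0 //.
  by rewrite sumr_ge0.
apply: (le_trans (ler_norm_sum _ _ _)); apply: ler_sum => j _.
by rewrite normrM ler_piMr // (le_trans (ler_coord_enorm _ _ _)).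
Qed.

Lemma enorm_mulmx m n (A : 'M[R]_(m, n)) (v : 'cV[R]_n) :
  enorm (A *m v) <= opnorm A * enorm v.
Proof.
have [/eqP /(enorm_eq0 _) ->|v0] := boolP (enorm v == 0).
  rewrite mulmx0 -(scale0r 0) -[X in _ <= _ * enorm X](scale0r 0).
  by rewrite !enormZ normr0 !mul0r mulr0.
have vgt0 : 0 < enorm v by rewrite lt_def v0 enorm_ge0.
rewrite -ler_pdivrMr // mulrC -[_^-1]gtr0_norm ?invr_gt0 // -enormZ scalemxAr.
apply: sup_upper_bound; first exact: has_sup_opnorm.
exists ((enorm v)^-1 *: v) => //=.
by rewrite enormZ gtr0_norm ?invr_gt0 // mulVf.
Qed.

End EuclideanNorm.

(** * Gossip matrices and contraction of the disagreement *)

Section Gossip.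
Context {R : realType} {n : nat} (W : 'M[R]_n) (W_ds : doubly_stochastic W).

Lemma doubly_stochastic_row_sum i : \sum_j W i j = 1.
Proof.
have [/matrixP /(_ i 0) W1 _] := W_ds; move: W1; rewrite !mxE => <-.
by apply: eq_bigr => j _; rewrite mxE mulr1.
Qed.

Lemma doubly_stochastic_col_sum j : \sum_i W i j = 1.
Proof.
have [_ /matrixP /(_ 0 j)] := W_ds; rewrite !mxE => <-.
by apply: eq_bigr => i _; rewrite !mxE mul1r.
Qed.

Lemma doubly_stochastic_sum (w : 'cV[R]_n) :
  \sum_i (W *m w) i 0 = \sum_i w i 0.
Proof.
under eq_bigr => i _ do rewrite mxE.
rewrite exchange_big /=; apply: eq_bigr => j _.
by rewrite -mulr_suml doubly_stochastic_col_sum mul1r.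
Qed.

End Gossip.

(** The averaging matrix annihilates zero-sum vectors, so subtracting it from [W] does not change
    [W *m w]. *)
Lemma spectral_gap_contraction (R : realType) n (W : 'M[R]_n) (w : 'cV[R]_n) :
  \sum_i w i 0 = 0 -> enorm (W *m w) <= spectral_gap W * enorm w.
Proof.
move=> w0; suff -> : W *m w = (W - n%:R^-1 *: (ones n *m (ones n)^T)) *m w.
  exact: enorm_mulmx.
rewrite mulmxBl -scalemxAl -mulmxA.
suff -> : (ones n)^T *m w = 0 :> 'M[R]_1 by rewrite mulmx0 scaler0 subr0.
apply/matrixP => i j; rewrite !ord1 !mxE -[RHS]w0.
by apply: eq_bigr => k _; rewrite !mxE mul1r.
Qed.

(** Unit column sums keep the vector zero-sum, so the spectral gap contracts it again in every
    round. *)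
Lemma gossip_rounds (R : realType) n (m : nat) (sigma : R) (W : nat -> 'M[R]_n)
    (w : nat -> 'cV[R]_n) :
  0 <= sigma ->
  (forall l, (1 <= l <= m)%N ->
    doubly_stochastic (W l) /\ spectral_gap (W l) <= sigma) ->
  (forall l, (1 <= l <= m)%N -> w l = W l *m w l.-1) ->
  \sum_i w 0%N i 0 = 0 ->
  \sum_i w m i 0 = 0 /\ enorm (w m) <= sigma ^+ m * enorm (w 0%N).
Proof.
move=> sigma0 hW hw w0; suff : forall l, (l <= m)%N ->
    \sum_i w l i 0 = 0 /\ enorm (w l) <= sigma ^+ l * enorm (w 0%N) by exact.
elim=> [_|l IH lm]; first by rewrite mul1r.
have [sum0 le_w] := IH (ltnW lm); have [ds gap] := hW l.+1 lm.
rewrite (hw l.+1 lm) /= doubly_stochastic_sum //; split=> //.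
apply: (le_trans (spectral_gap_contraction _ _ _ _ sum0)).
apply: (le_trans (ler_wpM2r (enorm_ge0 _ _) gap)).
by rewrite exprS -mulrA ler_wpM2l.
Qed.

(** * First-order optimality and scalar estimates *)

Lemma sum_grad_minimizer (R : realType) (n d : nat) (f : 'I_n -> 'cV[R]_d -> R)
    (xs : 'cV[R]_d) :
  (forall i x, differentiable (f i) x) ->
  minimizer (fun x => n%:R^-1 * \sum_(i < n) f i x) xs ->
  \sum_(i < n) grad (f i) xs = 0.
Proof.
move=> fdiff fmin; apply/matrixP => j j0; rewrite ord1 {j0} summxE mxE.
pose e : 'cV[R]_d := delta_mx j 0.
(* Restriction to the line through [xs] along [e] reduces stationarity to a one-variable minimum at
   0. *)
pose g (h : R) : R := (\sum_(i < n) f i) (h *: e + xs).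
have gE h : g h = \sum_(i < n) f i (h *: e + xs) by rewrite /g fct_sumE.
have gdiff h : derivable g h 1.
  apply/derivable1_diffP; apply: differentiable_comp; first by [].
  exact: differentiable_sum.
have gmin h : g 0 <= g h.
  rewrite !gE scale0r add0r; have := fmin (h *: e + xs).
  case: (posnP n) => [n0|n_gt0].
    by rewrite !big1 // => i; have := ltn_ord i; rewrite [X in (_ < X)%N]n0.
  by rewrite ler_pM2l // invr_gt0 ltr0n.
have g'0 : is_derive (0 : R) 1 g 0.
  by apply: (@derive1_at_min _ g (-1) 1 0) => //; rewrite ?in_itv /=; lra.
transitivity ('D_1 g 0); last exact: derive_val.
transitivity ('D_e (\sum_(i < n) f i) xs).
  rewrite derive_sum; last by move=> i; exact: diff_derivable.
  by apply: eq_bigr => i _; rewrite mxE.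
(* Both derivatives are limits of the same difference quotient. *)
rewrite /derive; set q1 := fun _ => _; set q2 := fun _ => _.
suff -> : q1 = q2 by [].
by apply/funext => h; rewrite /q1 /q2 /g /= addr0 scale0r add0r [_%:A]mulr1.
Qed.

(** Since [ln b] is negative, clearing the denominator reverses the inequality. *)
Lemma exp_le_of_log_base_le (R : realType) (b a : R) (m : nat) :
  0 < b -> b < 1 -> 0 < a -> log_base b a <= m%:R -> b ^+ m <= a.
Proof.
move=> b0 b1 a0; rewrite /log_base ler_ndivrMr ?ln_lt0 ?b0 // => h.
by rewrite -ler_ln ?posrE ?exprn_gt0 // lnXn // -mulr_natl.
Qed.

Lemma sqr_half_sub_sqrt (R : realType) (rho : R) : 0 < rho -> rho < 1 ->
  ((Num.sqrt (1 + rho) - Num.sqrt (1 - rho)) / 2) ^+ 2 =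
    (1 - Num.sqrt (1 - rho ^+ 2)) / 2.
Proof.
move=> r0 r1; have -> : 1 - rho ^+ 2 = (1 + rho) * (1 - rho) by ring.
rewrite sqrtrM ?addr_ge0 ?ltW //.
have := @sqr_sqrtr _ (1 + rho); have := @sqr_sqrtr _ (1 - rho).
rewrite subr_ge0 addr_ge0 ?ltW // => /(_ isT) h1 /(_ isT) h2.
by rewrite expr_div_n sqrrB h1 h2; field.
Qed.

(** * Decrease and coercivity of the Lyapunov function *)

Lemma lyapunov_coordinate (R : realType) n (s a : R) (x y v : 'I_n -> R) :
  0 <= s <= 1 ->
  \sum_i y i = 0 -> \sum_i (x i - a) = 0 -> \sum_i (v i - a) = 0 ->
  \sum_i (v i - a) ^+ 2 <= (1 - s) / 2 * \sum_i (x i - a) ^+ 2 ->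
  \sum_i ((1 - s ^+ 2) * v i ^+ 2 + s * (1 - s) * (y i + x i - v i) ^+ 2) <=
  (1 - s ^+ 2) * \sum_i (x i ^+ 2 + 2 * s * (x i * y i) + s * y i ^+ 2).
Proof.
move=> /andP[s0 s1] y0 x0 v0 hv; rewrite mulr_sumr -subr_le0 -sumrB.
(* Complete the square in the disagreement variables [x - a] and [v - a]; the
   remaining terms are linear and sum to zero. *)
rewrite (eq_bigr (fun i =>
    - (1 - s) * (s * y i + s * (x i - a) + (v i - a)) ^+ 2
    + 2 * (1 - s ^+ 2) * (v i - a) ^+ 2
    - 2 * (1 - s ^+ 2) * ((1 - s) / 2) * (x i - a) ^+ 2
    + 2 * (1 - s ^+ 2) * a * (v i - a) - 2 * (1 - s ^+ 2) * a * (x i - a)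
    - 2 * (1 - s ^+ 2) * s * a * y i)); last by move=> i _; field.
rewrite !big_split /= !sumrN -!mulr_sumr y0 x0 v0 !mulr0 !subr0 addr0.
have sq : 0 <= \sum_i (s * y i + s * (x i - a) + (v i - a)) ^+ 2.
  by rewrite sumr_ge0 // => i _; exact: sqr_ge0.
have := mulr_ge0 (_ : 0 <= 1 - s) sq.
have := ler_wpM2l (_ : 0 <= 1 - s ^+ 2) hv.
have -> : 0 <= 1 - s ^+ 2 by nra.
have -> : 0 <= 1 - s by lra.
move=> /(_ isT) h1 /(_ isT) h2; lra.
Qed.

(* Equals [|x + s y|^2 + s (1 - s) |y|^2 = (1 - s) |x|^2 + s |x + y|^2]. *)
Definition lyapunov {R : realType} {n d} (s : R) (x y : 'I_n -> 'cV[R]_d) : R :=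
  \sum_i \sum_c (x i c 0 ^+ 2 + 2 * s * (x i c 0 * y i c 0) + s * y i c 0 ^+ 2).

Lemma lyapunov_step (R : realType) n d (s : R) (x y u v : 'I_n -> 'cV[R]_d) :
  0 <= s <= 1 -> \sum_i y i = 0 ->
  (forall i, enorm (u i) ^+ 2 <= (1 - s ^+ 2) * enorm (v i) ^+ 2) ->
  (forall c, exists a : R,
    [/\ \sum_i (x i c 0 - a) = 0, \sum_i (v i c 0 - a) = 0 &
        \sum_i (v i c 0 - a) ^+ 2 <=
          (1 - s) / 2 * \sum_i (x i c 0 - a) ^+ 2]) ->
  lyapunov s (fun i => u i - s *: (y i + x i - v i))
             (fun i => y i + x i - v i) <= (1 - s ^+ 2) * lyapunov s x y.
Proof.
move=> s01 y0 hu hv.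
apply: (@le_trans _ _ (\sum_i \sum_c ((1 - s ^+ 2) * v i c 0 ^+ 2
    + s * (1 - s) * (y i c 0 + x i c 0 - v i c 0) ^+ 2))).
  (* With z the new y, substituting u - s z for x turns each summand of [lyapunov] into u^2 + s (1 -
     s) z^2, and [hu] bounds the u part. *)
  apply: ler_sum => i _; rewrite [leRHS]big_split /= -mulr_sumr.
  have := hu i; rewrite !sqr_enorm -(lerD2r (\sum_c
    s * (1 - s) * (y i c 0 + x i c 0 - v i c 0) ^+ 2)) -big_split /=.
  apply: le_trans; apply: ler_sum => c _; rewrite !mxE.
  by rewrite le_eqVlt; apply/orP; left; apply/eqP; ring.
(* Exchanging the sums over agents and coordinates leaves one scalar inequality per coordinate. *)
rewrite /lyapunov exchange_big [in leRHS]exchange_big /= mulr_sumr.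
apply: ler_sum => c _; have [a [xa va le_va]] := hv c.
apply: (lyapunov_coordinate _ _ s a) => //.
by have /matrixP /(_ c 0) := y0; rewrite summxE mxE.
Qed.

Lemma lyapunov_coercive (R : realType) n d (s : R) (x y : 'I_n -> 'cV[R]_d) i :
  0 <= s <= 1 -> (1 - s) * enorm (x i) ^+ 2 <= lyapunov s x y.
Proof.
move=> /andP[s0 s1].
have sqE j c : x j c 0 ^+ 2 + 2 * s * (x j c 0 * y j c 0) + s * y j c 0 ^+ 2
    = (1 - s) * x j c 0 ^+ 2 + s * (x j c 0 + y j c 0) ^+ 2 by ring.
rewrite /lyapunov; under eq_bigr => j _ do under eq_bigr => c _ do rewrite sqE.
have ge0 j c : 0 <= (1 - s) * x j c 0 ^+ 2 + s * (x j c 0 + y j c 0) ^+ 2.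
  by rewrite addr_ge0 // mulr_ge0 ?sqr_ge0 // subr_ge0.
rewrite (bigD1 i) //= sqr_enorm mulr_sumr -[leLHS]addr0 lerD //.
  by apply: ler_sum => c _; rewrite lerDl mulr_ge0 ?sqr_ge0.
by do 2 (apply: sumr_ge0 => ? _).
Qed.

(** * Linear convergence of the iterates *)

Theorem theorem1 (R : realType) (n d : nat) (n_ge1 : (1 <= n)%N)
  (d_ge1 : (1 <= d)%N)
  (f : 'I_n -> 'cV[R]_d -> R)
  (f_diff : forall i x, differentiable (f i) x)
  (xs : 'cV[R]_d) (alpha rho sigma : R)
  (alpha_gt0 : 0 < alpha)
  (rho_gt0 : 0 < rho) (rho_lt1 : rho < 1)
  (sigma_gt0 : 0 < sigma) (sigma_lt1 : sigma < 1)
  (xs_min : minimizer (fun x => n%:R^-1 * \sum_(i < n) f i x) xs)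
  (f_contr : forall (x : 'cV[R]_d) (i : 'I_n),
    enorm (x - xs - alpha *: (grad (f i) x - grad (f i) xs))
      <= rho * enorm (x - xs))
  (m : nat)
  (m_def : m%:Z = Num.ceil
    (log_base sigma ((Num.sqrt (1 + rho) - Num.sqrt (1 - rho)) / 2)))
  (net : nat -> nat -> rel 'I_n) (W : nat -> nat -> 'M[R]_n)
  (W_net : forall k l, (1 <= l <= m)%N ->
    [/\ gossip_matrix (net k l) (W k l),
        doubly_stochastic (W k l) &
        spectral_gap (W k l) <= sigma])
  (x y u : nat -> 'I_n -> 'cV[R]_d) (v : nat -> nat -> 'I_n -> 'cV[R]_d)
  (run : algorithm f alpha rho m W x y u v) :
  forall i : 'I_n,
    (fun k : nat => enorm (x k i - xs)) =O_\oo (fun k : nat => rho ^+ k).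
Proof.
case: run => y_init v_init v_comm uE yE xE i.
set tau := (_ / 2) in m_def.
set s := Num.sqrt (1 - rho ^+ 2) in xE.
have s2E : s ^+ 2 = 1 - rho ^+ 2.
  by rewrite sqr_sqrtr // subr_ge0 expr_le1 // ltW.
have s_gt0 : 0 < s by rewrite sqrtr_gt0 subr_gt0 exprn_ilt1 // ltW.
have s_lt1 : s < 1 by rewrite -(@ltr_pXn2r _ 2) ?nnegrE ?ltW // s2E; nra.
have tau2E : tau ^+ 2 = (1 - s) / 2 by exact: sqr_half_sub_sqrt.
have tau_gt0 : 0 < tau by rewrite divr_gt0 // subr_gt0 ltr_sqrt; lra.
have sigma_m : sigma ^+ m <= tau.
  apply: exp_le_of_log_base_le => //; have := ceil_ge (log_base sigma tau).
  by rewrite -m_def.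
(* Errors relative to the fixed point, where u_i is [xs - alpha *: grad (f i) xs]; hence the shift
   in [U]. *)
pose ys i : 'cV[R]_d := - (alpha / s) *: grad (f i) xs.
pose X k i := x k i - xs.
pose Y k i := y k i - ys i.
pose V k i := v k m i - xs.
pose U k i := u k i - xs + alpha *: grad (f i) xs.
have XE k : X k.+1 = fun i => U k i - s *: (Y k i + X k i - V k i).
  apply/funext => j; rewrite /X /U /Y /V xE yE /ys.
  apply/matrixP => c c'; rewrite !mxE; field; lra.
have YE k : Y k.+1 = fun i => Y k i + X k i - V k i.
  apply/funext => j; rewrite /X /Y /V yE.
  by apply/matrixP => c c'; rewrite !mxE; ring.
have sum_comm k c : exists a : R,
    [/\ \sum_i (X k i c 0 - a) = 0, \sum_i (V k i c 0 - a) = 0 &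
        \sum_i (V k i c 0 - a) ^+ 2 <=
          (1 - s) / 2 * \sum_i (X k i c 0 - a) ^+ 2].
  (* The mean over agents of the error in coordinate [c]; [w l] stacks the centered errors after
     round [l]. *)
  pose a : R := n%:R^-1 * \sum_i X k i c 0; exists a.
  pose w l : 'cV[R]_n := \col_j (v k l j c 0 - xs c 0 - a).
  have w0E j : w 0%N j 0 = X k j c 0 - a by rewrite !mxE v_init.
  have wmE j : w m j 0 = V k j c 0 - a by rewrite !mxE.
  have X0 : \sum_i (X k i c 0 - a) = 0.
    rewrite sumrB sumr_const card_ord -mulr_natl mulVKf ?subrr //.
    by rewrite pnatr_eq0 -lt0n.
  case: (@gossip_rounds R n m sigma (W k) w (ltW sigma_gt0)).
  - by move=> l /(W_net k) [_ ds gap].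
  - move=> l lm; have [_ ds _] := W_net k l lm.
    apply/matrixP => j j'; rewrite !mxE v_comm // summxE.
    (* Unit row sums preserve constants, so centering commutes with communication. *)
    under [RHS]eq_bigr => q _ do rewrite mxE -addrA mulrDr.
    rewrite big_split /= -mulr_suml (doubly_stochastic_row_sum _ ds) mul1r.
    rewrite addrA.
    by congr (_ - _ - _); apply: eq_bigr => q _; rewrite mxE.
  - by under eq_bigr => j _ do rewrite w0E.
  under eq_bigr => j _ do rewrite wmE.
  move=> V0 le_w; split=> //.
  have : enorm (w m) <= tau * enorm (w 0%N).
    by rewrite (le_trans le_w) // ler_wpM2r // enorm_ge0.
  rewrite -(@ler_pXn2r _ 2) ?nnegrE ?enorm_ge0
    ?(mulr_ge0 (ltW tau_gt0)) ?enorm_ge0 //.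
  rewrite exprMn !sqr_enorm tau2E.
  under eq_bigr => j _ do rewrite wmE.
  by under [in leRHS]eq_bigr => j _ do rewrite w0E.
(* Optimality of [xs] gives the base case; afterwards [X k] and [V k] have equal sums in each
   coordinate, so the update preserves the sum. *)
have sumY k : \sum_i Y k i = 0.
  elim: k => [|k IH].
    rewrite sumrB y_init -scaler_sumr sum_grad_minimizer //.
    by rewrite scaler0 subr0.
  rewrite YE; apply/matrixP => c c'; rewrite ord1 {c'} summxE mxE.
  have [a [X0 V0 _]] := sum_comm k c.
  have /matrixP /(_ c 0) := IH; rewrite summxE mxE => Y0.
  under eq_bigr => j _ do rewrite !mxE.
  transitivity (
      \sum_i Y k i c 0 + \sum_i (X k i c 0 - a) - \sum_i (V k i c 0 - a)).
    by rewrite -sumrN -!big_split /=; apply: eq_bigr => j _; rewrite !mxE; ring.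
  by rewrite X0 Y0 V0 subr0 addr0.
have step k : lyapunov s (X k.+1) (Y k.+1) <= rho ^+ 2 * lyapunov s (X k) (Y k).
  have rE : rho ^+ 2 = 1 - s ^+ 2 by rewrite s2E; ring.
  rewrite XE YE rE; apply: lyapunov_step => //; first by lra.
  move=> j; rewrite -rE -exprMn ler_pXn2r ?nnegrE
    ?(mulr_ge0 (ltW rho_gt0)) ?enorm_ge0 //.
  (* [U k j] is exactly the vector that [f_contr] bounds at [v k m j]. *)
  apply: le_trans (f_contr (v k m j) j).
  rewrite le_eqVlt; apply/orP; left; apply/eqP; congr enorm.
  by rewrite /U uE; apply/matrixP => c c'; rewrite !mxE; ring.
have lyap k : lyapunov s (X k) (Y k) <=
    (rho ^+ k) ^+ 2 * lyapunov s (X 0%N) (Y 0%N).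
  elim: k => [|k IH]; first by rewrite expr0 expr1n mul1r.
  apply: (le_trans (step k)); rewrite [rho ^+ k.+1]exprS exprMn -[leRHS]mulrA.
  by rewrite ler_wpM2l // sqr_ge0.
(* Coercivity and [lyap] give |X k i|^2 <= C rho^(2k). The added 1 below keeps the constant positive
   even when [C] is 0. *)
pose C := lyapunov s (X 0%N) (Y 0%N) / (1 - s).
apply/eqO_exP; exists (Num.sqrt C + 1); first by rewrite ltr_wpDl // sqrtr_ge0.
apply: filterE => k.
rewrite !ger0_norm ?enorm_ge0 ?exprn_ge0 ?(ltW rho_gt0) //.
apply: (@le_trans _ _ (Num.sqrt C * rho ^+ k)); last first.
  by rewrite ler_wpM2r ?exprn_ge0 ?(ltW rho_gt0) // lerDl.
rewrite -[rho ^+ k]ger0_norm ?exprn_ge0 ?(ltW rho_gt0) // -sqrtr_sqr mulrC.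
rewrite -sqrtrM ?sqr_ge0 //.
rewrite -[leLHS]ger0_norm ?enorm_ge0 // -sqrtr_sqr ler_wsqrtr //.
rewrite /C mulrA ler_pdivlMr ?subr_gt0 // mulrC.
apply: le_trans (lyap k); apply: lyapunov_coercive; lra.
Qed.
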